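(* If $\mathcal{C}$ is an algebraically coherent semi-abelian category, then for every object $X$ of $\mathcal{C}$ the kernel functor $\mathrm{Ker}\colon \mathsf{Pt}_X(\mathcal{C})\to\mathcal{C}$ reflects Huq commutators. Hence $\mathcal{C}$ satisfies (SSH): for every object $X$ of $\mathcal{C}$, the kernel functor $\mathrm{Ker}\colon \mathsf{Pt}_X(\mathcal{C})\to\mathcal{C}$ reflects Huq commutativity of arbitrary cospans, i.e., if $(u,v)$ is any cospan in $\mathsf{Pt}_X(\mathcal{C})$ such that $\mathrm{Ker}(u)$ and $\mathrm{Ker}(v)$ commute in the Huq sense in $\mathcal{C}$, then $u$ and $v$ commute in the Huq sense in $\mathsf{Pt}_X(\mathcal{C})$.
   Context: A category is semi-abelian if it is pointed, Barr exact, protomodular and has binary coproducts. A category is protomodular if it has pullbacks of split epimorphisms along any map and all change-of-base functors between its categories of points (defined below) reflect isomorphisms. A cospan $(f\colon X\to Z,\ g\colon Y\to Z)$ in a category with finite limits is jointly strongly epimorphic if every monomorphism into $Z$ through which both $f$ and $g$ factor is an isomorphism. A functor between categories with finite limits is coherent if it preserves finite limits and jointly strongly epimorphic pairs. $\mathsf{Pt}_X(\mathcal{C})$ is the category of points over $X$: objects are triples $(A,\ p\colon A\to X,\ s\colon X\to A)$ with $ps=1_X$, and morphisms are morphisms between the objects $A$ commuting with the $p$'s and the $s$'s; this is a pointed category with zero object $(X,1_X,1_X)$. For $f\colon X\to Y$, the change-of-base functor $f^*\colon \mathsf{Pt}_Y(\mathcal{C})\to\mathsf{Pt}_X(\mathcal{C})$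 is pulling back along $f$. A category $\mathcal{C}$ with finite limits is algebraically coherent if $f^*$ is coherent for every morphism $f$ of $\mathcal{C}$. The kernel functor $\mathrm{Ker}\colon\mathsf{Pt}_X(\mathcal{C})\to\mathcal{C}$ sends $(A,p,s)$ to the kernel of $p$ (it is the change-of-base functor along $0\to X$). In a pointed category with finite products, two morphisms $k\colon K\to Z$, $l\colon L\to Z$ commute in the Huq sense if there is a morphism $\varphi\colon K\times L\to Z$ with $\varphi\langle 1_K,0\rangle=k$ and $\varphi\langle 0,1_L\rangle=l$. That a functor ''reflects Huq commutators'' means that a cospan commutes in the Huq sense whenever its image under the functor does. *)

(* Defs.v *)
From Stdlib Require Import Bool List FinFun Eqdep_dec ProofIrrelevance.

Set Implicit Arguments.
Unset Strict Implicit.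
Unset Printing Implicit Defensive.

Record Category := {
  Ob :> Type;
  Hom : Ob -> Ob -> Type;
  idm : forall A, Hom A A;
  comp : forall A B D, Hom B D -> Hom A B -> Hom A D;
  comp_id_l : forall A B (f : Hom A B), comp (idm B) f = f;
  comp_id_r : forall A B (f : Hom A B), comp f (idm A) = f;
  comp_assoc : forall A B D E (h : Hom D E) (g : Hom B D) (f : Hom A B),
    comp h (comp g f) = comp (comp h g) f
}.

Arguments Hom {c} _ _.
Arguments idm {c} _.
Arguments comp {c A B D} _ _.

Declare Scope cat_scope.
Delimit Scope cat_scope with cat.
Open Scope cat_scope.
Notation "g ∘ f" := (comp g f) (at level 40, left associativity) : cat_scope.

Record Functor (C D : Category) := {
  fob :> C -> D;
  fmap : forall A B : C, Hom A B -> Hom (fob A) (fob B);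
  fmap_id : forall A : C, fmap (idm A) = idm (fob A);
  fmap_comp : forall (A B E : C) (g : Hom B E) (f : Hom A B),
    fmap (g ∘ f) = fmap g ∘ fmap f
}.

Arguments fmap {C D} _ {A B} _.

Program Definition functor_comp (C D E : Category)
    (G : Functor D E) (F : Functor C D) : Functor C E := {|
  fob := fun A => G (F A);
  fmap := fun A B f => fmap G (fmap F f)
|}.
Next Obligation. now rewrite !fmap_id. Qed.
Next Obligation. now rewrite !fmap_comp. Qed.

Definition IsIso (C : Category) (A B : C) (f : Hom A B) : Prop :=
  exists g : Hom B A, g ∘ f = idm A /\ f ∘ g = idm B.

Definition Mono (C : Category) (A B : C) (f : Hom A B) : Prop :=
  forall (T : C) (a b : Hom T A), f ∘ a = f ∘ b -> a = b.

Definition ReflectsIsos (C D : Category) (F : Functor C D) : Prop :=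
  forall (A B : C) (f : Hom A B), IsIso (fmap F f) -> IsIso f.

Record Cone (J C : Category) (D : Functor J C) := {
  apex : C;
  leg : forall j : J, Hom apex (D j);
  leg_nat : forall (i j : J) (a : Hom i j), fmap D a ∘ leg i = leg j
}.

Arguments leg {J C D} _ _.

Definition ConeMap (J C : Category) (D : Functor J C) (c' c : Cone D)
    (h : Hom (apex c') (apex c)) : Prop :=
  forall j : J, leg c j ∘ h = leg c' j.

Definition IsLimit (J C : Category) (D : Functor J C) (c : Cone D) : Prop :=
  forall c' : Cone D, exists! h : Hom (apex c') (apex c), ConeMap h.

(* Limits are chosen, so that change-of-base functors are actual functors. *)
Record Limit (J C : Category) (D : Functor J C) := {
  limit_cone : Cone D;
  limit_univ : forall c' : Cone D,
    { h : Hom (apex c') (apex limit_cone) | unique (@ConeMap _ _ _ c' limit_cone) h }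
}.

Definition FiniteCategory (J : Category) : Prop :=
  Finite J /\ forall i j : J, Finite (Hom i j).

Definition FiniteLimits (C : Category) : Type :=
  forall J : Category, FiniteCategory J -> forall D : Functor J C, Limit D.

Program Definition map_cone (J C E : Category) (F : Functor C E) (D : Functor J C)
    (c : Cone D) : Cone (functor_comp F D) := {|
  apex := F (apex c);
  leg := fun j => fmap F (leg c j)
|}.
Next Obligation. now rewrite <- fmap_comp, leg_nat. Qed.

Definition PreservesFiniteLimits (C E : Category) (F : Functor C E) : Prop :=
  forall J : Category, FiniteCategory J -> forall (D : Functor J C) (c : Cone D),
    IsLimit c -> IsLimit (map_cone F c).

Definition IsPullback (C : Category) (A B D P : C) (f : Hom A D) (g : Hom B D)
    (p : Hom P A) (q : Hom P B) : Prop :=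
  f ∘ p = g ∘ q /\
  forall (T : C) (a : Hom T A) (b : Hom T B), f ∘ a = g ∘ b ->
    exists! h : Hom T P, p ∘ h = a /\ q ∘ h = b.

Record Pullback (C : Category) (A B D : C) (f : Hom A D) (g : Hom B D) := {
  pb_ob : C;
  pb_fst : Hom pb_ob A;
  pb_snd : Hom pb_ob B;
  pb_comm : f ∘ pb_fst = g ∘ pb_snd;
  pb_lift : forall (T : C) (a : Hom T A) (b : Hom T B),
    f ∘ a = g ∘ b -> Hom T pb_ob;
  pb_lift_fst : forall (T : C) (a : Hom T A) (b : Hom T B) (e : f ∘ a = g ∘ b),
    pb_fst ∘ pb_lift e = a;
  pb_lift_snd : forall (T : C) (a : Hom T A) (b : Hom T B) (e : f ∘ a = g ∘ b),
    pb_snd ∘ pb_lift e = b;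
  pb_ext : forall (T : C) (h k : Hom T pb_ob),
    pb_fst ∘ h = pb_fst ∘ k -> pb_snd ∘ h = pb_snd ∘ k -> h = k
}.

Arguments pb_lift {C A B D f g} _ {T a b} _.

Inductive cospan_ob : Set := cs_left | cs_right | cs_target.

(* The thin category left -> target <- right. *)
Definition cospan_le (i j : cospan_ob) : bool :=
  match i, j with
  | cs_left, cs_left | cs_right, cs_right | _, cs_target => true
  | _, _ => false
  end.

Program Definition cospan_shape : Category := {|
  Ob := cospan_ob;
  Hom := fun i j => cospan_le i j = true
|}.
Next Obligation. now destruct A. Defined.
Next Obligation. now destruct A, B, D. Defined.
Next Obligation. apply UIP_dec, bool_dec. Qed.
Next Obligation. apply UIP_dec, bool_dec. Qed.
Next Obligation. apply UIP_dec, bool_dec. Qed.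

Lemma cospan_shape_finite : FiniteCategory cospan_shape.
Proof.
  split.
  - exists (cs_left :: cs_right :: cs_target :: nil). intros []; simpl; tauto.
  - intros i j. destruct (cospan_le i j) eqn:e.
    + exists (e :: nil). intros a. left. apply UIP_dec, bool_dec.
    + exists nil. intros a. simpl in a. congruence.
Qed.

Section CospanDiagram.
Context (C : Category) (A B D : C) (f : Hom A D) (g : Hom B D).

Definition cospan_fob (i : cospan_ob) : C :=
  match i with cs_left => A | cs_right => B | cs_target => D end.

Definition cospan_fmap (i j : cospan_ob) :
    cospan_le i j = true -> Hom (cospan_fob i) (cospan_fob j) :=
  match i, j with
  | cs_left, cs_left => fun _ => idm A
  | cs_right, cs_right => fun _ => idm B
  | cs_target, cs_target => fun _ => idm D
  | cs_left, cs_target => fun _ => f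
  | cs_right, cs_target => fun _ => g
  | _, _ => fun e => False_rect _ (diff_false_true e)
  end.

Definition cospan_diagram : Functor cospan_shape C.
Proof.
  refine (Build_Functor (C := cospan_shape) (D := C) (fob := cospan_fob)
            (fmap := fun i j a => @cospan_fmap i j a) _ _).
  - intros []; reflexivity.
  - intros [] [] [] b a; try discriminate a; try discriminate b; simpl;
      now rewrite ?comp_id_l, ?comp_id_r.
Defined.

Definition cospan_cone (T : C) (a : Hom T A) (b : Hom T B) (e : f ∘ a = g ∘ b) :
  Cone cospan_diagram.
Proof.
  refine (Build_Cone (D := cospan_diagram) (apex := T)
    (leg := fun i => match i return Hom T (cospan_fob i) with
                     | cs_left => a | cs_right => b | cs_target => f ∘ a end) _).
  intros [] [] x; try discriminate x; simpl; now rewrite ?comp_id_l.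
Defined.

Definition pullback_of_limit (L : Limit cospan_diagram) : Pullback f g.
Proof.
  pose (c := limit_cone L).
  refine (@Build_Pullback C A B D f g (apex c) (leg c cs_left) (leg c cs_right) _
            (fun T a b e => proj1_sig (limit_univ L (cospan_cone e))) _ _ _).
  - exact (eq_trans (@leg_nat _ _ _ c cs_left cs_target eq_refl)
            (eq_sym (@leg_nat _ _ _ c cs_right cs_target eq_refl))).
  - intros T a b e. exact (proj1 (proj2_sig (limit_univ L (cospan_cone e))) cs_left).
  - intros T a b e. exact (proj1 (proj2_sig (limit_univ L (cospan_cone e))) cs_right).
  - intros T h k el er.
    assert (E : f ∘ (leg c cs_left ∘ k) = g ∘ (leg c cs_right ∘ k)).
    { rewrite !comp_assoc. f_equal.
      exact (eq_trans (@leg_nat _ _ _ c cs_left cs_target eq_refl)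
              (eq_sym (@leg_nat _ _ _ c cs_right cs_target eq_refl))). }
    assert (U : forall m : Hom T (apex c), leg c cs_left ∘ m = leg c cs_left ∘ k ->
                leg c cs_right ∘ m = leg c cs_right ∘ k ->
                ConeMap (c' := cospan_cone E) (c := c) m).
    { intros m ml mr [].
      - exact ml.
      - exact mr.
      - refine (eq_trans _ (f_equal (fun x : Hom T A => f ∘ x) ml)).
        refine (eq_trans _ (eq_sym (comp_assoc f (leg c cs_left : Hom (apex c) A) m))).
        exact (f_equal (fun x : Hom (apex c) D => x ∘ m)
                 (eq_sym (@leg_nat _ _ _ c cs_left cs_target eq_refl))). }
    destruct (proj2_sig (limit_univ L (cospan_cone E))) as [_ Hu].
    rewrite <- (Hu h (U h el er)). exact (Hu k (U k eq_refl eq_refl)).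
Defined.

End CospanDiagram.

Definition finlim_pullback (C : Category) (L : FiniteLimits C) (A B D : C)
    (f : Hom A D) (g : Hom B D) : Pullback f g :=
  pullback_of_limit (L cospan_shape cospan_shape_finite (cospan_diagram f g)).

Record ZeroObject (C : Category) := {
  zero_ob : C;
  from_zero : forall A : C, Hom zero_ob A;
  to_zero : forall A : C, Hom A zero_ob;
  from_zero_unique : forall (A : C) (f : Hom zero_ob A), f = from_zero A;
  to_zero_unique : forall (A : C) (f : Hom A zero_ob), f = to_zero A
}.

Definition zero_map (C : Category) (Z : ZeroObject C) (A B : C) : Hom A B :=
  from_zero Z B ∘ to_zero Z A.

Record BinaryProduct (C : Category) (A B : C) := {
  prod_ob : C;
  prod_fst : Hom prod_ob A;
  prod_snd : Hom prod_ob B;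
  prod_pair : forall T : C, Hom T A -> Hom T B -> Hom T prod_ob;
  prod_pair_fst : forall (T : C) (a : Hom T A) (b : Hom T B),
    prod_fst ∘ prod_pair a b = a;
  prod_pair_snd : forall (T : C) (a : Hom T A) (b : Hom T B),
    prod_snd ∘ prod_pair a b = b;
  prod_ext : forall (T : C) (h k : Hom T prod_ob),
    prod_fst ∘ h = prod_fst ∘ k -> prod_snd ∘ h = prod_snd ∘ k -> h = k
}.

Arguments prod_pair {C A B} _ {T} _ _.

Record PointedWithProducts (C : Category) := {
  pwp_zero : ZeroObject C;
  pwp_prod : forall A B : C, BinaryProduct A B
}.

Definition HuqCommute (C : Category) (S : PointedWithProducts C) (K L Z : C)
    (k : Hom K Z) (l : Hom L Z) : Prop :=
  let KL := pwp_prod S K L in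
  exists phi : Hom (prod_ob KL) Z,
    phi ∘ prod_pair KL (idm K) (zero_map (pwp_zero S) K L) = k /\
    phi ∘ prod_pair KL (zero_map (pwp_zero S) L K) (idm L) = l.

Definition ReflectsHuqCommutators (C D : Category)
    (SC : PointedWithProducts C) (SD : PointedWithProducts D) (F : Functor C D) : Prop :=
  forall (K L Z : C) (k : Hom K Z) (l : Hom L Z),
    HuqCommute SD (fmap F k) (fmap F l) -> HuqCommute SC k l.

Definition finlim_product (C : Category) (Z : ZeroObject C) (L : FiniteLimits C)
    (A B : C) : BinaryProduct A B.
Proof.
  pose (P := finlim_pullback L (to_zero Z A) (to_zero Z B)).
  assert (E : forall (T : C) (a : Hom T A) (b : Hom T B),
             to_zero Z A ∘ a = to_zero Z B ∘ b).
  { intros T a b. now rewrite (to_zero_unique (to_zero Z A ∘ a)),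
      (to_zero_unique (to_zero Z B ∘ b)). }
  refine (@Build_BinaryProduct C A B (pb_ob P) (pb_fst P) (pb_snd P)
            (fun T a b => pb_lift P (E T a b)) _ _ _).
  - intros. apply pb_lift_fst.
  - intros. apply pb_lift_snd.
  - intros T h k. apply pb_ext.
Defined.

Record Point (C : Category) (X : C) := {
  pt_ob : C;
  pt_proj : Hom pt_ob X;
  pt_sect : Hom X pt_ob;
  pt_split : pt_proj ∘ pt_sect = idm X
}.

Record PointHom (C : Category) (X : C) (P Q : Point X) := {
  pt_map : Hom (pt_ob P) (pt_ob Q);
  pt_map_proj : pt_proj Q ∘ pt_map = pt_proj P;
  pt_map_sect : pt_map ∘ pt_sect P = pt_sect Q
}.

Lemma point_hom_eq (C : Category) (X : C) (P Q : Point X) (u v : PointHom P Q) :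
  pt_map u = pt_map v -> u = v.
Proof.
  destruct u as [u up us], v as [v vp vs]; simpl; intros e; subst v.
  f_equal; apply proof_irrelevance.
Qed.

Program Definition Pt (C : Category) (X : C) : Category := {|
  Ob := Point X;
  Hom := fun P Q => PointHom P Q;
  idm := fun P => {| pt_map := idm (pt_ob P) |};
  comp := fun P Q R v u => {| pt_map := pt_map v ∘ pt_map u |}
|}.
Next Obligation. apply comp_id_r. Qed.
Next Obligation. apply comp_id_l. Qed.
Next Obligation. now rewrite comp_assoc, !pt_map_proj. Qed.
Next Obligation. now rewrite <- comp_assoc, !pt_map_sect. Qed.
Next Obligation. apply point_hom_eq, comp_id_l. Qed.
Next Obligation. apply point_hom_eq, comp_id_r. Qed.
Next Obligation. apply point_hom_eq, comp_assoc. Qed.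

Program Definition pt_forget (C : Category) (X : C) : Functor (Pt X) C := {|
  fob := fun P : Pt X => pt_ob P;
  fmap := fun (P Q : Pt X) (u : Hom P Q) => pt_map u
|}.

Definition PointPullbacks (C : Category) : Type :=
  forall (X Y : C) (f : Hom X Y) (P : Point Y), Pullback f (pt_proj P).

Section ChangeOfBase.
Context (C : Category) (H : PointPullbacks C) (X Y : C) (f : Hom X Y).

Lemma cob_sect_comm (P : Point Y) : f ∘ idm X = pt_proj P ∘ (pt_sect P ∘ f).
Proof. now rewrite comp_assoc, pt_split, comp_id_l, comp_id_r. Qed.

Definition cob_ob (P : Point Y) : Point X := {|
  pt_ob := pb_ob (H f P);
  pt_proj := pb_fst (H f P);
  pt_sect := pb_lift (H f P) (cob_sect_comm P);
  pt_split := pb_lift_fst (H f P) (cob_sect_comm P)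
|}.

Lemma cob_map_comm (P Q : Point Y) (u : PointHom P Q) :
  f ∘ pb_fst (H f P) = pt_proj Q ∘ (pt_map u ∘ pb_snd (H f P)).
Proof. rewrite comp_assoc, pt_map_proj. apply pb_comm. Qed.

Program Definition cob_map (P Q : Point Y) (u : PointHom P Q) :
    PointHom (cob_ob P) (cob_ob Q) := {|
  pt_map := pb_lift (H f Q) (cob_map_comm u)
|}.
Next Obligation. apply pb_lift_fst. Qed.
Next Obligation.
  apply pb_ext; rewrite comp_assoc.
  - now rewrite !pb_lift_fst.
  - now rewrite !pb_lift_snd, <- comp_assoc, pb_lift_snd, comp_assoc, pt_map_sect.
Qed.

Program Definition change_of_base : Functor (Pt Y) (Pt X) := {|
  fob := fun P : Pt Y => cob_ob P : Pt X;
  fmap := fun (P Q : Pt Y) (u : Hom P Q) => cob_map u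
|}.
Next Obligation.
  apply point_hom_eq; simpl; apply pb_ext.
  - now rewrite pb_lift_fst, comp_id_r.
  - now rewrite pb_lift_snd, comp_id_l, comp_id_r.
Qed.
Next Obligation.
  apply point_hom_eq; simpl; apply pb_ext; rewrite comp_assoc.
  - now rewrite !pb_lift_fst.
  - now rewrite !pb_lift_snd, <- !comp_assoc, pb_lift_snd.
Qed.

End ChangeOfBase.

Definition finlim_point_pullbacks (C : Category) (L : FiniteLimits C) : PointPullbacks C :=
  fun X Y f P => finlim_pullback L f (pt_proj P).

Program Definition pt_zero (C : Category) (X : C) : ZeroObject (Pt X) := {|
  zero_ob := {| pt_ob := X; pt_proj := idm X; pt_sect := idm X |} : Pt X;
  from_zero := fun P : Point X => {| pt_map := pt_sect P |};
  to_zero := fun P : Point X => {| pt_map := pt_proj P |}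
|}.
Next Obligation. apply comp_id_l. Qed.
Next Obligation. apply pt_split. Qed.
Next Obligation. apply comp_id_r. Qed.
Next Obligation. apply comp_id_l. Qed.
Next Obligation. apply pt_split. Qed.
Next Obligation.
  apply point_hom_eq; simpl. rewrite <- (pt_map_sect f); simpl.
  now rewrite comp_id_r.
Qed.
Next Obligation.
  apply point_hom_eq; simpl. rewrite <- (pt_map_proj f); simpl.
  now rewrite comp_id_l.
Qed.

Section PointProduct.
Context (C : Category) (H : PointPullbacks C) (X : C) (P Q : Point X).

Let PQ := H (pt_proj P) Q.

Lemma pt_prod_sect_comm : pt_proj P ∘ pt_sect P = pt_proj Q ∘ pt_sect Q.
Proof. now rewrite !pt_split. Qed.

Program Definition pt_prod_ob : Point X := {|
  pt_ob := pb_ob PQ;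
  pt_proj := pt_proj P ∘ pb_fst PQ;
  pt_sect := pb_lift PQ pt_prod_sect_comm
|}.
Next Obligation. now rewrite <- comp_assoc, pb_lift_fst, pt_split. Qed.

Lemma pt_prod_pair_comm (T : Point X) (a : PointHom T P) (b : PointHom T Q) :
  pt_proj P ∘ pt_map a = pt_proj Q ∘ pt_map b.
Proof. now rewrite !pt_map_proj. Qed.

Program Definition pt_prod : @BinaryProduct (Pt X) P Q := {|
  prod_ob := pt_prod_ob : Pt X;
  prod_fst := {| pt_map := pb_fst PQ |};
  prod_snd := {| pt_map := pb_snd PQ |};
  prod_pair := fun (T : Point X) (a : PointHom T P) (b : PointHom T Q) =>
    {| pt_map := pb_lift PQ (pt_prod_pair_comm a b) |}
|}.
Next Obligation. apply pb_lift_fst. Qed.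
Next Obligation. symmetry. apply pb_comm. Qed.
Next Obligation. apply pb_lift_snd. Qed.
Next Obligation. now rewrite <- comp_assoc, pb_lift_fst, pt_map_proj. Qed.
Next Obligation.
  apply pb_ext; rewrite comp_assoc.
  - now rewrite !pb_lift_fst, pt_map_sect.
  - now rewrite !pb_lift_snd, pt_map_sect.
Qed.
Next Obligation. apply point_hom_eq, pb_lift_fst. Qed.
Next Obligation. apply point_hom_eq, pb_lift_snd. Qed.
Next Obligation.
  apply point_hom_eq, pb_ext.
  - assumption.
  - assumption.
Qed.

End PointProduct.

Definition pt_pointed (C : Category) (H : PointPullbacks C) (X : C) :
    PointedWithProducts (Pt X) := {|
  pwp_zero := pt_zero X;
  pwp_prod := fun P Q : Pt X => pt_prod H P Q
|}.

(* Pt over the zero object is identified with C by forgetting the point structure. *)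
Definition Ker (C : Category) (Z : ZeroObject C) (H : PointPullbacks C) (X : C) :
    Functor (Pt X) C :=
  functor_comp (pt_forget (zero_ob Z)) (change_of_base H (from_zero Z X)).

Definition IsCoequalizer (C : Category) (R A Q : C) (a b : Hom R A) (q : Hom A Q) : Prop :=
  q ∘ a = q ∘ b /\
  forall (T : C) (t : Hom A T), t ∘ a = t ∘ b -> exists! h : Hom Q T, h ∘ q = t.

Definition RegularEpi (C : Category) (A Q : C) (q : Hom A Q) : Prop :=
  exists (R : C) (a b : Hom R A), IsCoequalizer a b q.

Record Regular (C : Category) (L : FiniteLimits C) : Prop := {
  kernel_pair_coequalizer : forall (A B R : C) (f : Hom A B) (r1 r2 : Hom R A),
    IsPullback f f r1 r2 -> exists (Q : C) (q : Hom A Q), IsCoequalizer r1 r2 q;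
  regular_epi_stable : forall (A B D P : C) (f : Hom A D) (g : Hom B D)
      (p : Hom P A) (q : Hom P B),
    IsPullback f g p q -> RegularEpi g -> RegularEpi p
}.

Record EquivalenceRelation (C : Category) (L : FiniteLimits C) (R X : C)
    (r1 r2 : Hom R X) : Prop := {
  er_jointly_monic : forall (T : C) (a b : Hom T R),
    r1 ∘ a = r1 ∘ b -> r2 ∘ a = r2 ∘ b -> a = b;
  er_refl : exists d : Hom X R, r1 ∘ d = idm X /\ r2 ∘ d = idm X;
  er_sym : exists s : Hom R R, r1 ∘ s = r2 /\ r2 ∘ s = r1;
  er_trans : let P := finlim_pullback L r2 r1 in
    exists t : Hom (pb_ob P) R, r1 ∘ t = r1 ∘ pb_fst P /\ r2 ∘ t = r2 ∘ pb_snd P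
}.

Definition Effective (C : Category) (R X : C) (r1 r2 : Hom R X) : Prop :=
  exists (Y : C) (f : Hom X Y), IsPullback f f r1 r2.

Record BarrExact (C : Category) := {
  be_limits : FiniteLimits C;
  be_regular : Regular be_limits;
  be_effective : forall (R X : C) (r1 r2 : Hom R X),
    EquivalenceRelation be_limits r1 r2 -> Effective r1 r2
}.

Definition Protomodular (C : Category) (H : PointPullbacks C) : Prop :=
  forall (X Y : C) (f : Hom X Y), ReflectsIsos (change_of_base H f).

Definition IsCoproduct (C : Category) (A B S : C) (i : Hom A S) (j : Hom B S) : Prop :=
  forall (T : C) (a : Hom A T) (b : Hom B T),
    exists! h : Hom S T, h ∘ i = a /\ h ∘ j = b.

Record SemiAbelian (C : Category) := {
  sa_zero : ZeroObject C;
  sa_exact : BarrExact C;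
  sa_protomodular : Protomodular (finlim_point_pullbacks (be_limits sa_exact));
  sa_coproducts : forall A B : C, exists (S : C) (i : Hom A S) (j : Hom B S),
    IsCoproduct i j
}.

Definition sa_limits (C : Category) (S : SemiAbelian C) : FiniteLimits C :=
  be_limits (sa_exact S).

Definition sa_point_pullbacks (C : Category) (S : SemiAbelian C) : PointPullbacks C :=
  finlim_point_pullbacks (sa_limits S).

Definition sa_pointed (C : Category) (S : SemiAbelian C) : PointedWithProducts C := {|
  pwp_zero := sa_zero S;
  pwp_prod := finlim_product (sa_zero S) (sa_limits S)
|}.

Definition sa_ker (C : Category) (S : SemiAbelian C) (X : C) : Functor (Pt X) C :=
  Ker (sa_zero S) (sa_point_pullbacks S) X.

Definition JointlyStronglyEpic (C : Category) (X Y Z : C) (f : Hom X Z) (g : Hom Y Z) : Prop :=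
  forall (M : C) (m : Hom M Z), Mono m ->
    (exists f' : Hom X M, m ∘ f' = f) -> (exists g' : Hom Y M, m ∘ g' = g) -> IsIso m.

Definition PreservesJointlyStronglyEpic (C D : Category) (F : Functor C D) : Prop :=
  forall (X Y Z : C) (f : Hom X Z) (g : Hom Y Z),
    JointlyStronglyEpic f g -> JointlyStronglyEpic (fmap F f) (fmap F g).

Definition Coherent (C D : Category) (F : Functor C D) : Prop :=
  PreservesFiniteLimits F /\ PreservesJointlyStronglyEpic F.

Definition AlgebraicallyCoherent (C : Category) (L : FiniteLimits C) : Prop :=
  forall (X Y : C) (f : Hom X Y), Coherent (change_of_base (finlim_point_pullbacks L) f).

Definition SSH (C : Category) (S : SemiAbelian C) : Prop :=
  forall (X : C) (K L Z : Pt X) (u : Hom K Z) (v : Hom L Z),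
    HuqCommute (sa_pointed S) (fmap (sa_ker S X) u) (fmap (sa_ker S X) v) ->
    HuqCommute (pt_pointed (sa_point_pullbacks S) X) u v.

(* Main.v *)
Require Import Defs.

(** Write [D] for the category of points over [X] and [F] for the kernel functor.
    Let [u : K -> Z] and [v : L -> Z] be a cospan in [D] whose image commutes by
    means of [phi : F K × F L -> F Z].  A morphism witnessing that [u] and [v]
    commute is determined by its graph, a subobject of [Z × (K × L)], and there is
    only one candidate for that graph: the join [M] of the two subobjects
    [⟨u,⟨1,0⟩⟩] and [⟨v,⟨0,1⟩⟩].  It is a graph exactly when the projection
    [c : M -> K × L] is invertible, and this may be tested after applying [F],
    because protomodularity says that [F] reflects isomorphisms.

    Algebraic coherence says that [F M] is still the join of the images of [F K]
    and [F L].  These two factor through the graph of [phi], so all of [F M] lies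
    in that graph, which means that [F M -> F K × F L] is a monomorphism.  Since
    both inclusions into [F K × F L] factor through it, it is an isomorphism
    ([protomodular_unital]), and so is [F c].

    The argument is carried out in [reflects_huq_commutators] for any functor with
    the properties that it needs.  Joins of points are formed in the base category
    as the regular image of [K + L] ([pt_joint_images]); this avoids constructing
    coproducts of points, which would be pushouts over [X]. *)

Set Implicit Arguments.
Unset Strict Implicit.
Unset Printing Implicit Defensive.

(** * Jointly strongly epic and jointly monic pairs *)

Definition JointlyMonic (C : Category) (A B T : C) (f : Hom T A) (g : Hom T B) : Prop :=
  forall (U : C) (a b : Hom U T), f ∘ a = f ∘ b -> g ∘ a = g ∘ b -> a = b.

Definition PreservesJointlyMonic (C D : Category) (F : Functor C D) : Prop :=
  forall (A B T : C) (f : Hom T A) (g : Hom T B),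
    JointlyMonic f g -> JointlyMonic (fmap F f) (fmap F g).

Definition HasJointImages (C : Category) : Prop :=
  forall (A B W : C) (k : Hom A W) (l : Hom B W),
    exists (M : C) (m : Hom M W) (k' : Hom A M) (l' : Hom B M),
      Mono m /\ m ∘ k' = k /\ m ∘ l' = l /\ JointlyStronglyEpic k' l'.

Definition Unital (C : Category) (S : PointedWithProducts C) : Prop :=
  forall A B : C,
    JointlyStronglyEpic
      (prod_pair (pwp_prod S A B) (idm A) (zero_map (pwp_zero S) A B))
      (prod_pair (pwp_prod S A B) (zero_map (pwp_zero S) B A) (idm B)).

Lemma mono_split_epi_iso (C : Category) (A B : C) (m : Hom A B) (r : Hom B A) :
  Mono m -> m ∘ r = idm B -> IsIso m.
Proof.
  intros hm e. exists r. split; [|exact e].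
  apply hm. now rewrite comp_assoc, e, comp_id_l, comp_id_r.
Qed.

Lemma prod_pair_comp (C : Category) (A B T U : C) (P : BinaryProduct A B)
    (a : Hom T A) (b : Hom T B) (h : Hom U T) :
  prod_pair P a b ∘ h = prod_pair P (a ∘ h) (b ∘ h).
Proof.
  apply prod_ext; rewrite comp_assoc;
    now rewrite ?prod_pair_fst, ?prod_pair_snd.
Qed.

(** The equalizer of [a] and [b] is the pullback of their graphs; a jointly
    strongly epic pair that factors through it makes it everything. *)
Lemma jointly_strongly_epic_cancel (C : Category) (L : FiniteLimits C)
    (S : PointedWithProducts C) (X Y Z T : C) (f : Hom X Z) (g : Hom Y Z)
    (a b : Hom Z T) :
  JointlyStronglyEpic f g -> a ∘ f = b ∘ f -> a ∘ g = b ∘ g -> a = b.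
Proof.
  intros hfg ef eg.
  pose (P := pwp_prod S Z T).
  pose (E := finlim_pullback L (prod_pair P (idm Z) a) (prod_pair P (idm Z) b)).
  assert (e1 : pb_fst E = pb_snd E).
  { pose proof (f_equal (fun h => prod_fst P ∘ h) (pb_comm E)) as e.
    cbv beta in e.
    now rewrite !comp_assoc, !prod_pair_fst, !comp_id_l in e. }
  assert (e2 : a ∘ pb_fst E = b ∘ pb_fst E).
  { pose proof (f_equal (fun h => prod_snd P ∘ h) (pb_comm E)) as e.
    cbv beta in e.
    rewrite !comp_assoc, !prod_pair_snd in e. now rewrite e1 at 2. }
  assert (lift : forall (U : C) (h : Hom U Z), a ∘ h = b ∘ h ->
             exists h' : Hom U (pb_ob E), pb_fst E ∘ h' = h).
  { intros U h eh.
    assert (e : prod_pair P (idm Z) a ∘ h = prod_pair P (idm Z) b ∘ h)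
      by now rewrite !prod_pair_comp, eh.
    exists (pb_lift E e). apply pb_lift_fst. }
  destruct (hfg _ (pb_fst E)) as [r [_ hr]].
  - intros U x y exy. apply pb_ext; [exact exy|]. now rewrite <- e1.
  - now apply lift.
  - now apply lift.
  - rewrite <- (comp_id_r a), <- (comp_id_r b), <- hr, !comp_assoc.
    now rewrite e2.
Qed.

(** * Reflection of Huq commutators by coherent conservative functors *)

(** Preservation of finite limits enters through zero morphisms and jointly monic
    pairs only.  In particular the product projections give a monomorphism
    [t : F (K × L) -> F K × F L], which is enough to compare the two products. *)
Theorem reflects_huq_commutators (D E : Category) (L : FiniteLimits E)
    (SD : PointedWithProducts D) (SE : PointedWithProducts E) (F : Functor D E) :
  HasJointImages D -> Unital SE ->
  PreservesJointlyStronglyEpic F -> PreservesJointlyMonic F ->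
  (forall A B : D, fmap F (zero_map (pwp_zero SD) A B) = zero_map (pwp_zero SE) (F A) (F B)) ->
  ReflectsIsos F ->
  ReflectsHuqCommutators SD SE F.
Proof.
  intros himg hun hjse hjm hz hiso K L' Z u v.
  unfold HuqCommute. cbv zeta.
  set (P := pwp_prod SD K L'). set (Q := pwp_prod SE (F K) (F L')).
  set (iK := prod_pair P (idm K) _). set (iL := prod_pair P _ (idm L')).
  intros [phi [phiK phiL]].
  set (W := pwp_prod SD Z (prod_ob P)).
  destruct (himg _ _ _ (prod_pair W u iK) (prod_pair W v iL))
    as (M & m & k & l & hm & ek & el & hkl).
  set (z := prod_fst W ∘ m). set (c := prod_snd W ∘ m).
  assert (zk : z ∘ k = u) by (unfold z; now rewrite <- comp_assoc, ek, prod_pair_fst).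
  assert (zl : z ∘ l = v) by (unfold z; now rewrite <- comp_assoc, el, prod_pair_fst).
  assert (ck : c ∘ k = iK) by (unfold c; now rewrite <- comp_assoc, ek, prod_pair_snd).
  assert (cl : c ∘ l = iL) by (unfold c; now rewrite <- comp_assoc, el, prod_pair_snd).
  assert (hzc : JointlyMonic z c).
  { intros U a b ez ec. apply hm; apply (prod_ext (b0 := W)); now rewrite !comp_assoc. }
  set (t := prod_pair Q (fmap F (prod_fst P)) (fmap F (prod_snd P))).
  assert (ht : Mono t).
  { intros U a b eab.
    assert (hP : JointlyMonic (prod_fst P) (prod_snd P))
      by (intros V x y; apply prod_ext).
    apply (hjm _ _ _ _ _ hP).
    - rewrite <- (prod_pair_fst Q (fmap F (prod_fst P)) (fmap F (prod_snd P))).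
      fold t. now rewrite <- !comp_assoc, eab.
    - rewrite <- (prod_pair_snd Q (fmap F (prod_fst P)) (fmap F (prod_snd P))).
      fold t. now rewrite <- !comp_assoc, eab. }
  assert (tk : t ∘ fmap F c ∘ fmap F k = prod_pair Q (idm _) (zero_map (pwp_zero SE) _ _)).
  { rewrite <- comp_assoc, <- fmap_comp, ck. unfold t, iK.
    now rewrite prod_pair_comp, <- !fmap_comp, prod_pair_fst, prod_pair_snd, fmap_id, hz. }
  assert (tl : t ∘ fmap F c ∘ fmap F l = prod_pair Q (zero_map (pwp_zero SE) _ _) (idm _)).
  { rewrite <- comp_assoc, <- fmap_comp, cl. unfold t, iL.
    now rewrite prod_pair_comp, <- !fmap_comp, prod_pair_fst, prod_pair_snd, fmap_id, hz. }
  (* The equation says that [F M] is contained in the graph of [phi]; it holds on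
     [F K] and [F L] by the choice of [phi], and these generate [F M]. *)
  assert (graph : fmap F z = phi ∘ (t ∘ fmap F c)).
  { apply (jointly_strongly_epic_cancel L SE (hjse _ _ _ _ _ hkl)).
    - rewrite <- fmap_comp, zk, <- comp_assoc, tk. now symmetry.
    - rewrite <- fmap_comp, zl, <- comp_assoc, tl. now symmetry. }
  assert (mono_tc : Mono (t ∘ fmap F c)).
  { intros U a b eab. apply (hjm _ _ _ _ _ hzc).
    - now rewrite graph, <- !(comp_assoc phi), eab.
    - apply ht. now rewrite !comp_assoc. }
  assert (iso_tc : IsIso (t ∘ fmap F c))
    by exact (hun _ _ _ _ mono_tc (ex_intro _ _ tk) (ex_intro _ _ tl)).
  destruct iso_tc as [r [r1 r2]].
  assert (iso_Fc : IsIso (fmap F c)).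
  { exists (r ∘ t). split.
    - now rewrite <- comp_assoc.
    - apply ht. now rewrite !comp_assoc, r2, comp_id_l, comp_id_r. }
  destruct (hiso _ _ _ iso_Fc) as [d [dc _]].
  exists (z ∘ d). split.
  - now rewrite <- ck, <- comp_assoc, (comp_assoc d), dc, comp_id_l.
  - now rewrite <- cl, <- comp_assoc, (comp_assoc d), dc, comp_id_l.
Qed.

(** * Joint images of points *)

Lemma pullback_is_pullback (C : Category) (A B D : C) (f : Hom A D) (g : Hom B D)
    (P : Pullback f g) : IsPullback f g (pb_fst P) (pb_snd P).
Proof.
  split; [apply pb_comm|]. intros T a b e. exists (pb_lift P e). split.
  - split; [apply pb_lift_fst|apply pb_lift_snd].
  - intros h [h1 h2]. apply pb_ext.
    + now rewrite pb_lift_fst.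
    + now rewrite pb_lift_snd.
Qed.

Lemma coequalizer_epi (C : Category) (R A Q T : C) (r1 r2 : Hom R A) (q : Hom A Q)
    (x y : Hom Q T) : IsCoequalizer r1 r2 q -> x ∘ q = y ∘ q -> x = y.
Proof.
  intros [eq hq] e.
  destruct (hq T (y ∘ q)) as [h [_ hu]].
  - now rewrite <- !comp_assoc, eq.
  - rewrite <- (hu x e). now apply hu.
Qed.

Lemma regular_epi_epi (C : Category) (A Q T : C) (q : Hom A Q) (x y : Hom Q T) :
  RegularEpi q -> x ∘ q = y ∘ q -> x = y.
Proof. intros (R & a & b & h). exact (coequalizer_epi h). Qed.

(** The elements [a] and [b] of [Q] lift to [A] after passing to a cover of their
    domain; there the lifts have the same image under [f], hence are identified by
    the coequalizer of its kernel pair. *)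
Lemma regular_image (C : Category) (L : FiniteLimits C) (HR : Regular L)
    (A B : C) (f : Hom A B) :
  exists (Q : C) (q : Hom A Q) (m : Hom Q B), RegularEpi q /\ Mono m /\ m ∘ q = f.
Proof.
  pose (R := finlim_pullback L f f).
  destruct (kernel_pair_coequalizer HR (pullback_is_pullback R)) as (Q & q & hq).
  destruct (proj2 hq B f (pb_comm R)) as [m [em _]].
  assert (rq : RegularEpi q) by (exists (pb_ob R), (pb_fst R), (pb_snd R); exact hq).
  exists Q, q, m. split; [exact rq|]. split; [|exact em].
  intros T a b eab.
  pose (Pa := finlim_pullback L a q).
  pose (Pb := finlim_pullback L (b ∘ pb_fst Pa) q).
  apply (regular_epi_epi (regular_epi_stable HR (pullback_is_pullback Pa) rq)).
  apply (regular_epi_epi (regular_epi_stable HR (pullback_is_pullback Pb) rq)).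
  assert (ex : a ∘ pb_fst Pa ∘ pb_fst Pb = q ∘ (pb_snd Pa ∘ pb_fst Pb))
    by now rewrite (pb_comm Pa), comp_assoc.
  assert (exy : f ∘ (pb_snd Pa ∘ pb_fst Pb) = f ∘ pb_snd Pb).
  { rewrite <- em, <- !(comp_assoc m), <- ex, <- (pb_comm Pb), !(comp_assoc m).
    now rewrite eab. }
  pose proof (pb_lift_fst R exy) as h1. pose proof (pb_lift_snd R exy) as h2.
  set (h := pb_lift R exy) in *. clearbody h.
  rewrite ex, (pb_comm Pb), <- h1, <- h2, !comp_assoc. now rewrite (proj1 hq).
Qed.

(** Maps out of a coproduct turn the cospan into one morphism [A + B -> W], whose
    regular image is the join. *)
Lemma joint_images (C : Category) (L : FiniteLimits C) (HR : Regular L) :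
  (forall A B : C, exists (S : C) (i : Hom A S) (j : Hom B S), IsCoproduct i j) ->
  HasJointImages C.
Proof.
  intros hcop A B W k l.
  destruct (hcop A B) as (S & i & j & hS).
  destruct (hS W k l) as [f [[fi fj] _]].
  destruct (regular_image HR f) as (M & q & m & (R & a & b & hq) & hm & emq).
  exists M, m, (q ∘ i), (q ∘ j).
  split; [exact hm|]. rewrite !comp_assoc, emq. split; [exact fi|]. split; [exact fj|].
  intros N n hn [x ex] [y ey].
  destruct (hS N x y) as [h [[hi hj] _]].
  assert (nh : n ∘ h = q).
  { destruct (hS M (q ∘ i) (q ∘ j)) as [p [_ hu]].
    rewrite <- (hu q (conj eq_refl eq_refl)). symmetry. apply hu.
    now rewrite <- !comp_assoc, hi, hj. }
  destruct (proj2 hq N h) as [r [er _]].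
  { apply hn. rewrite !comp_assoc, nh. exact (proj1 hq). }
  apply (mono_split_epi_iso (r := r) hn). apply (coequalizer_epi hq).
  now rewrite <- comp_assoc, er, nh, comp_id_l.
Qed.

Lemma pt_iso (C : Category) (X : C) (P Q : Pt X) (f : Hom P Q) :
  IsIso (pt_map f) -> IsIso f.
Proof.
  intros [g [gf fg]].
  assert (gp : pt_proj P ∘ g = pt_proj Q).
  { now rewrite <- (pt_map_proj f), <- comp_assoc, fg, comp_id_r. }
  assert (gs : g ∘ pt_sect Q = pt_sect P).
  { now rewrite <- (pt_map_sect f), comp_assoc, gf, comp_id_l. }
  exists (Build_PointHom gp gs : @Hom (Pt X) Q P).
  split; apply point_hom_eq; assumption.
Qed.

(** The kernel pair of a morphism of points is itself a point, so it suffices to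
    test monicity against points. *)
Lemma pt_mono_forget (C : Category) (L : FiniteLimits C) (X : C)
    (P Q : Pt X) (f : Hom P Q) : Mono f -> Mono (pt_map f).
Proof.
  intros hf T a b eab.
  pose (R := finlim_pullback L (pt_map f) (pt_map f)).
  pose (s := pb_lift R (eq_refl (pt_map f ∘ pt_sect P))).
  assert (e1 : pt_proj P ∘ pb_fst R ∘ s = idm X).
  { unfold s. now rewrite <- comp_assoc, pb_lift_fst, pt_split. }
  pose (RP := {| pt_ob := pb_ob R; pt_proj := pt_proj P ∘ pb_fst R;
                 pt_sect := s; pt_split := e1 |} : Pt X).
  assert (e2 : pt_proj P ∘ pb_snd R = pt_proj P ∘ pb_fst R).
  { rewrite <- (pt_map_proj f), <- !comp_assoc. now rewrite (pb_comm R). }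
  pose (p1 := Build_PointHom (P := RP) (Q := P) (eq_refl : pt_proj P ∘ pb_fst R = pt_proj RP)
                (pb_lift_fst R eq_refl) : @Hom (Pt X) RP P).
  pose (p2 := Build_PointHom (P := RP) (Q := P) e2
                (pb_lift_snd R eq_refl) : @Hom (Pt X) RP P).
  assert (e : p1 = p2).
  { apply hf. apply point_hom_eq. exact (pb_comm R). }
  rewrite <- (pb_lift_fst R eab).
  refine (eq_trans _ (pb_lift_snd R eab)).
  exact (f_equal (fun p : PointHom RP P => pt_map p ∘ pb_lift R eab) e).
Qed.

(** A pair is jointly monic when its pairing into the product, here the fibre
    product over [X], is a monomorphism. *)
Lemma pt_jointly_monic_forget (C : Category) (L : FiniteLimits C) (X : C)
    (A B T : Pt X) (f : Hom T A) (g : Hom T B) :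
  JointlyMonic f g -> JointlyMonic (pt_map f) (pt_map g).
Proof.
  intros hfg.
  pose proof (finlim_point_pullbacks L) as H. set (P := pt_prod H A B).
  assert (hp : Mono (prod_pair P f g)).
  { intros U a b e. apply hfg.
    - now rewrite <- (prod_pair_fst P f g), <- !comp_assoc, e.
    - now rewrite <- (prod_pair_snd P f g), <- !comp_assoc, e. }
  intros U a b ef eg. apply (pt_mono_forget L hp). simpl.
  apply pb_ext; rewrite !comp_assoc.
  - now rewrite !pb_lift_fst.
  - now rewrite !pb_lift_snd.
Qed.

(** The image formed in the base category is a point: its two possible sections,
    through [A] and through [B], agree because they do so in [W]. *)
Lemma pt_joint_images (C : Category) (L : FiniteLimits C) (X : C) :
  HasJointImages C -> HasJointImages (Pt X).
Proof.
  intros himg A B W k l.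
  destruct (himg _ _ _ (pt_map k) (pt_map l)) as (M & m & k' & l' & hm & ek & el & hkl).
  assert (ms : m ∘ (k' ∘ pt_sect A) = pt_sect W).
  { rewrite comp_assoc, ek. apply pt_map_sect. }
  assert (e : pt_proj W ∘ m ∘ (k' ∘ pt_sect A) = idm X).
  { now rewrite <- comp_assoc, ms, pt_split. }
  pose (MP := Build_Point e : Pt X).
  assert (kp : pt_proj W ∘ m ∘ k' = pt_proj A).
  { now rewrite <- comp_assoc, ek, pt_map_proj. }
  assert (lp : pt_proj W ∘ m ∘ l' = pt_proj B).
  { now rewrite <- comp_assoc, el, pt_map_proj. }
  assert (ls : l' ∘ pt_sect B = k' ∘ pt_sect A).
  { apply hm. rewrite ms, comp_assoc, el. apply pt_map_sect. }
  pose (mP := Build_PointHom (P := MP) (Q := W) eq_refl ms : @Hom (Pt X) MP W).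
  pose (kP := Build_PointHom (P := A) (Q := MP) kp eq_refl : @Hom (Pt X) A MP).
  pose (lP := Build_PointHom (P := B) (Q := MP) lp ls : @Hom (Pt X) B MP).
  exists MP, mP, kP, lP.
  split; [|split; [|split]].
  - intros T a b eab. apply point_hom_eq, hm. exact (f_equal (@pt_map _ _ _ _) eab).
  - now apply point_hom_eq.
  - now apply point_hom_eq.
  - intros N n hn [x ex] [y ey]. apply pt_iso. apply hkl.
    + exact (pt_mono_forget L hn).
    + exists (pt_map x). exact (f_equal (@pt_map _ _ _ _) ex).
    + exists (pt_map y). exact (f_equal (@pt_map _ _ _ _) ey).
Qed.

(** * The kernel functor *)

Lemma zero_target_unique (C : Category) (Z : ZeroObject C) (A : C)
    (f g : Hom A (zero_ob Z)) : f = g.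
Proof. now rewrite (to_zero_unique f), (to_zero_unique g). Qed.

Lemma zero_source_unique (C : Category) (Z : ZeroObject C) (A : C)
    (f g : Hom (zero_ob Z) A) : f = g.
Proof. now rewrite (from_zero_unique f), (from_zero_unique g). Qed.

Section Kernel.
Context (C : Category) (Z : ZeroObject C) (H : PointPullbacks C) (X : C).

Notation K := (Ker Z H X).
Notation incl P := (pb_snd (H (from_zero Z X) P)).

Lemma ker_incl_mono (P : Pt X) : Mono (incl P).
Proof. intros T a b e. apply pb_ext; [apply zero_target_unique|exact e]. Qed.

Lemma ker_incl_nat (P Q : Pt X) (f : Hom P Q) :
  incl Q ∘ fmap K f = pt_map f ∘ incl P.
Proof. apply pb_lift_snd. Qed.

Lemma ker_incl_nat_comp (P Q : Pt X) (f : Hom P Q) (T : C) (a : Hom T (K P)) :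
  incl Q ∘ (fmap K f ∘ a) = pt_map f ∘ (incl P ∘ a).
Proof.
  rewrite !comp_assoc. exact (f_equal (fun h => h ∘ a) (ker_incl_nat f)).
Qed.

Lemma ker_zero_map (P Q : Pt X) :
  fmap K (zero_map (pt_zero X) P Q) = zero_map Z (K P) (K Q).
Proof.
  apply (@ker_incl_mono Q). rewrite ker_incl_nat. simpl.
  unfold zero_map. rewrite <- comp_assoc, <- (pb_comm (H (from_zero Z X) P)), !comp_assoc.
  rewrite (zero_source_unique (pt_sect Q ∘ from_zero Z X)
             (incl Q ∘ from_zero Z (K Q))).
  f_equal. apply zero_target_unique.
Qed.

Lemma ker_reflects_isos : ReflectsIsos (change_of_base H (from_zero Z X)) -> ReflectsIsos K.
Proof. intros h P Q f hf. apply h. now apply pt_iso. Qed.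

(** A subobject of a point over the zero object is again such a point. *)
Lemma ker_preserves_jointly_strongly_epic :
  PreservesJointlyStronglyEpic (change_of_base H (from_zero Z X)) ->
  PreservesJointlyStronglyEpic K.
Proof.
  intros h A B D f g hfg N n hn [x ex] [y ey].
  set (F := change_of_base H (from_zero Z X)) in *.
  pose (NP := {| pt_ob := N; pt_proj := to_zero Z N; pt_sect := from_zero Z N;
                 pt_split := zero_target_unique _ _ |} : Pt (zero_ob Z)).
  pose (over := fun (P Q : Pt (zero_ob Z)) (t : Hom (pt_ob P) (pt_ob Q)) =>
    {| pt_map := t; pt_map_proj := zero_target_unique _ _;
       pt_map_sect := zero_source_unique _ _ |} : @Hom (Pt (zero_ob Z)) P Q).
  destruct (h _ _ _ _ _ hfg NP (over NP (F D) n)) as [r [r1 r2]].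
  - intros T a b eab. apply point_hom_eq, hn. exact (f_equal (@pt_map _ _ _ _) eab).
  - exists (over (F A) NP x). now apply point_hom_eq.
  - exists (over (F B) NP y). now apply point_hom_eq.
  - exists (pt_map r). split.
    + exact (f_equal (@pt_map _ _ _ _) r1).
    + exact (f_equal (@pt_map _ _ _ _) r2).
Qed.

Lemma ker_preserves_jointly_monic (L : FiniteLimits C) : PreservesJointlyMonic K.
Proof.
  intros A B T f g hfg U a b ef eg. apply (@ker_incl_mono T).
  apply (pt_jointly_monic_forget L hfg).
  - rewrite <- !ker_incl_nat_comp. now f_equal.
  - rewrite <- !ker_incl_nat_comp. now f_equal.
Qed.

End Kernel.

(** View [A × B] as a point over [B] with kernel [A].  A subobject [n] containing
    the section [⟨0,1⟩] is a morphism of points, and if it contains the kernel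
    [⟨1,0⟩] too, then it is invertible on kernels. *)
Lemma protomodular_unital (C : Category) (S : PointedWithProducts C)
    (H : PointPullbacks C) : Protomodular H -> Unital S.
Proof.
  intros hprot A B N n hn [a ea] [b eb].
  set (Z := pwp_zero S) in *. set (P := pwp_prod S A B) in *.
  assert (eP : prod_snd P ∘ prod_pair P (zero_map Z B A) (idm B) = idm B)
    by apply prod_pair_snd.
  assert (eN : prod_snd P ∘ n ∘ b = idm B) by now rewrite <- comp_assoc, eb.
  pose (PP := Build_Point eP : Pt B). pose (NP := Build_Point eN : Pt B).
  pose (nP := Build_PointHom (P := NP) (Q := PP) eq_refl eb : @Hom (Pt B) NP PP).
  pose (iP := pb_snd (H _ _ (from_zero Z B) PP)).
  assert (sP : prod_snd P ∘ iP = zero_map Z _ B).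
  { refine (eq_trans (eq_sym (pb_comm (H _ _ (from_zero Z B) PP))) _).
    unfold zero_map. f_equal. apply zero_target_unique. }
  assert (back : n ∘ (a ∘ (prod_fst P ∘ iP)) = iP).
  { rewrite comp_assoc, ea, prod_pair_comp, comp_id_l.
    apply prod_ext; rewrite ?prod_pair_fst, ?prod_pair_snd; [reflexivity|].
    rewrite sP. unfold zero_map. rewrite <- !comp_assoc. f_equal.
    apply zero_target_unique. }
  assert (e : from_zero Z B ∘ to_zero Z _ = prod_snd P ∘ n ∘ (a ∘ (prod_fst P ∘ iP))).
  { rewrite <- comp_assoc, back. now symmetry. }
  assert (iso : IsIso nP).
  { apply (ker_reflects_isos (hprot _ _ (from_zero Z B))).
    apply (mono_split_epi_iso (r := pb_lift (H _ _ (from_zero Z B) NP) e)).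
    - intros T x y exy. apply (@ker_incl_mono C Z H B NP). apply hn.
      refine (eq_trans (eq_sym (ker_incl_nat_comp nP x)) _).
      refine (eq_trans _ (ker_incl_nat_comp nP y)). now f_equal.
    - apply (@ker_incl_mono C Z H B PP).
      refine (eq_trans (ker_incl_nat_comp nP _) _).
      rewrite comp_id_r. refine (eq_trans _ back).
      exact (f_equal (fun h => n ∘ h) (pb_lift_snd _ e)). }
  destruct iso as [r [r1 r2]]. exists (pt_map r). split.
  - exact (f_equal (@pt_map _ _ _ _) r1).
  - exact (f_equal (@pt_map _ _ _ _) r2).
Qed.

Theorem theorem6p21 (C : Category) (S : SemiAbelian C)
    (HC : AlgebraicallyCoherent (sa_limits S)) :
  (forall X : C,
     ReflectsHuqCommutators (pt_pointed (sa_point_pullbacks S) X) (sa_pointed S)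
       (sa_ker S X))
  /\ SSH S.
Proof.
  enough (main : forall X : C,
     ReflectsHuqCommutators (pt_pointed (sa_point_pullbacks S) X) (sa_pointed S)
       (sa_ker S X)) by (split; [exact main|]; intros X K L Z; apply main).
  intros X. apply (reflects_huq_commutators (sa_limits S)).
  - apply (pt_joint_images (sa_limits S)).
    exact (joint_images (be_regular (sa_exact S)) (sa_coproducts S)).
  - exact (protomodular_unital (@sa_protomodular C S)).
  - apply ker_preserves_jointly_strongly_epic. exact (proj2 (HC _ _ _)).
  - exact (ker_preserves_jointly_monic (sa_limits S)).
  - apply ker_zero_map.
  - apply ker_reflects_isos. exact (@sa_protomodular C S _ _ _).
Qed.
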